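(* Let $E_1,E_2\ge2$ be integers and let $\kappa_1,\kappa_2<0$ be such that $$\overline\Delta=\overline\Delta_{(E_2,\,E_1E_2-1)}(\kappa)=\{x\in\mathbb R^2:\ x_1\ge0,\ \ell_1^{\kappa_1}(x)\ge0,\ \ell_2^{\kappa_2}(x)\ge0,\ -E_2x_1+(E_1E_2-1)x_2\ge0\},$$ where $\ell_1^{\kappa_1}(x)=x_2+\kappa_1$ and $\ell_2^{\kappa_2}(x)=-x_1+E_1x_2+\kappa_2$, is a minimal resolution (i.e. has four edges). A Lagrangian fiber $L_x$, $x\in\mathrm{Int}\,\overline\Delta$, is displaceable by probes or extended probes provided $x$ is not on the ray given by $$\ell_1^{\kappa_1}(x)=\ell_2^{\kappa_2}(x)\quad\text{and}\quad \ell_1^{\kappa_1}(x)\ge\max\{\ell_1^{\kappa_1}(y): y\in\overline\Delta,\ \ell_2^{\kappa_2}(y)=0\},$$ that is, $$x_1=(E_1-1)x_2+\kappa_2-\kappa_1\quad\text{and}\quad x_2\ge-E_2\kappa_2 .$$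
   Context: $\overline\Delta$ is a smooth polygon; let $(\overline M,\overline\omega,\overline\Phi)$ be the symplectic toric manifold with $\overline\Phi(\overline M)=\overline\Delta$ and $L_x=\overline\Phi^{-1}(x)$. (It is the minimal resolution of the toric orbifold with moment polytope $\{x_1\ge0,\,-nx_1+mx_2\ge0\}$, $(n,m)=(E_2,E_1E_2-1)$, for which $n/m=1/(E_1-1/E_2)$.) A set $X$ is displaceable if some compactly supported Hamiltonian diffeomorphism $\phi$ satisfies $\phi(X)\cap\overline X=\emptyset$. Probes and extended probes in a rational polygon $\Delta$ (facets $F\subset\{\langle\eta_F,x\rangle+\kappa_F=0\}$, $\eta_F$ primitive interior conormal). If $x-y=tv$ with $v$ primitive integral, $d_{\mathrm{aff}}(x,y)=|t|$; $d_{\mathrm{aff}}(x,F)=|\langle\eta_F,x\rangle+\kappa_F|$. A probe $P$ is a directed segment in $\Delta$ from $b_P$ in the interior of a facet $F_P$ to $b_P+\ell(P)v_P$, with $v_P\in\mathbb Z^2$ primitive and $\langle\eta_{F_P},v_P\rangle=1$; $\ell(P)$ is its length. For $u\in\mathrm{Int}\,\Delta$, $L_u$ is displaceable by probes or extended probes if one of the following holds (each implies that $L_u$ is displaceable): (a) $u\in P$ for a probe $P$ and $d_{\mathrm{aff}}(u,F_P)<\frac12\ell(P)$. (b) There are a symmetric probe $Q$ (its endpoint lies in the interior of a facet $F_Q'$ with $\langle\eta_{F_Q'},v_Q\rangle=-1$), with affine reflection $A_Q(x)=x+\langle\eta_{F_Q'}-\eta_{F_Q},x\rangle v_Q+(\kappa_{F_Q'}-\kappa_{F_Q})v_Q$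 and linear part $\widehat A_Q$, a probe $P$ ending at $x_{PQ}$ in the interior of $Q$, and a segment $P'\subset\Delta$ from $x_{PQ}'=A_Q(x_{PQ})$ to $x'_{PQ}+\ell(P')\widehat A_Q(v_P)$, such that either $u\in\mathrm{Int}\,P$ and $d_{\mathrm{aff}}(u,F_P)<\frac12(\ell(P)+\ell(P'))$, or $u\in\mathrm{Int}\,P'$ and $\ell(P)+d_{\mathrm{aff}}(x'_{PQ},u)<\frac12(\ell(P)+\ell(P'))$ (symmetric extended probe). (c) There are probes $P,Q$ with $P$ ending at $x_{PQ}\in Q$ and $v_P$ parallel to $F_Q$, points $x_{\mathcal F},x_{\mathcal F}'\in Q$ and $\ell(\mathcal F)\ge0$ such that the convex hull of $x_{\mathcal F},x'_{\mathcal F},x_{\mathcal F}+\ell(\mathcal F)v_P,x'_{\mathcal F}+\ell(\mathcal F)v_P$ lies in $\Delta$, $u\in\mathrm{Int}\,P$, $d_{\mathrm{aff}}(u,F_P)<\frac12(\ell(P)+\ell(\mathcal F))$ and $d_{\mathrm{aff}}(x_{PQ},F_Q)<d_{\mathrm{aff}}(x_{\mathcal F},x'_{\mathcal F})$ (parallel extended probe with flag). *)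

(* Defs.v *)
(* The plane is R * R for R : realType. *)
From mathcomp Require Import all_boot all_order all_algebra.
From mathcomp Require Import all_classical all_reals all_analysis.

Set Implicit Arguments.
Unset Strict Implicit.
Unset Printing Implicit Defensive.

Import Order.TTheory GRing.Theory Num.Theory.
Import numFieldNormedType.Exports.

Local Open Scope classical_set_scope.
Local Open Scope ring_scope.

Definition ivec (R : realType) (v : int * int) : R * R := (v.1%:~R, v.2%:~R).

Definition primitive (v : int * int) : bool := coprimez v.1 v.2.

Definition pairing (R : realType) (eta : int * int) (x : R * R) : R :=
  eta.1%:~R * x.1 + eta.2%:~R * x.2.

(* The half-plane <eta, x> + kappa >= 0 is encoded by the pair (eta, kappa). *)
Definition halfplane (R : realType) : Type := ((int * int) * R)%type.

Definition conormal (R : realType) (F : halfplane R) : int * int := F.1.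

Definition offset (R : realType) (F : halfplane R) : R := F.2.

Definition level (R : realType) (F : halfplane R) (x : R * R) : R :=
  pairing (conormal F) x + offset F.

(* A rational polygon is presented by the list D of its half-planes; its
   facets are named by the members of D. *)
Definition polygon (R : realType) (D : seq (halfplane R)) : set (R * R) :=
  [set x | forall F, F \in D -> 0 <= level F x].

Definition wall (R : realType) (F : halfplane R) : set (R * R) :=
  [set x | level F x = 0].

Definition facet (R : realType) (D : seq (halfplane R)) (F : halfplane R) :
  set (R * R) := polygon D `&` wall F.

(* F contributes a genuine (one-dimensional) edge, not a vertex or nothing. *)
Definition is_edge (R : realType) (D : seq (halfplane R)) (F : halfplane R) :
  Prop := exists x y, [/\ facet D F x, facet D F y & x <> y].

(* Relative interior: the interior of the facet in its supporting line. *)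
Definition facet_interior (R : realType) (D : seq (halfplane R))
    (F : halfplane R) : set (R * R) :=
  [set x | wall F x /\ \forall y \near within (wall F) (nbhs x), facet D F y].

(* The affine distance is only defined along rational directions, hence a
   relation; it is single-valued since v is unique up to sign when x <> y. *)
Definition affine_distance (R : realType) (x y : R * R) (d : R) : Prop :=
  exists (v : int * int) (t : R),
    [/\ primitive v, x - y = t *: ivec R v & d = `|t|].

Definition facet_distance (R : realType) (x : R * R) (F : halfplane R) : R :=
  `|level F x|.

Definition segment (R : realType) (b w : R * R) (l : R) : set (R * R) :=
  [set x | exists2 t : R, 0 <= t <= l & x = b + t *: w].

Definition open_segment (R : realType) (b w : R * R) (l : R) : set (R * R) :=
  [set x | exists2 t : R, 0 < t < l & x = b + t *: w].

Record probe_data (R : realType) : Type := ProbeData {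
  pfacet : halfplane R;
  pbase : R * R;
  pdir : int * int;
  plen : R
}.

Definition pend (R : realType) (P : probe_data R) : R * R :=
  pbase P + plen P *: ivec R (pdir P).

Definition probe_set (R : realType) (P : probe_data R) : set (R * R) :=
  segment (pbase P) (ivec R (pdir P)) (plen P).

Definition probe_interior (R : realType) (P : probe_data R) : set (R * R) :=
  open_segment (pbase P) (ivec R (pdir P)) (plen P).

Definition is_probe (R : realType) (D : seq (halfplane R)) (P : probe_data R) :
  Prop :=
  [/\ pfacet P \in D,
      facet_interior D (pfacet P) (pbase P),
      primitive (pdir P) /\ pairing (conormal (pfacet P)) (ivec R (pdir P)) = 1,
      0 < plen P
    & probe_set P `<=` polygon D].

Definition displaceable_by_probe (R : realType) (D : seq (halfplane R))
    (u : R * R) : Prop :=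
  exists P : probe_data R,
    [/\ is_probe D P, probe_set P u
      & facet_distance u (pfacet P) < 2^-1 * plen P].

Definition is_symmetric_probe (R : realType) (D : seq (halfplane R))
    (Q : probe_data R) (F' : halfplane R) : Prop :=
  [/\ is_probe D Q, F' \in D, facet_interior D F' (pend Q)
    & pairing (conormal F') (ivec R (pdir Q)) = -1].

Definition reflection_linear (R : realType) (Q : probe_data R)
    (F' : halfplane R) (w : R * R) : R * R :=
  w + pairing (conormal F' - conormal (pfacet Q)) w *: ivec R (pdir Q).

Definition reflection (R : realType) (Q : probe_data R) (F' : halfplane R)
    (x : R * R) : R * R :=
  x + pairing (conormal F' - conormal (pfacet Q)) x *: ivec R (pdir Q)
    + (offset F' - offset (pfacet Q)) *: ivec R (pdir Q).

Definition displaceable_by_symmetric_extended_probe (R : realType)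
    (D : seq (halfplane R)) (u : R * R) : Prop :=
  exists (Q : probe_data R) (F' : halfplane R) (P : probe_data R) (l' : R),
    let x' := reflection Q F' (pend P) in
    let w' := reflection_linear Q F' (ivec R (pdir P)) in
    [/\ is_symmetric_probe D Q F',
        is_probe D P /\ probe_interior Q (pend P),
        0 <= l',
        segment x' w' l' `<=` polygon D
      & (probe_interior P u /\
         facet_distance u (pfacet P) < 2^-1 * (plen P + l')) \/
        (open_segment x' w' l' u /\
         exists2 d : R, affine_distance x' u d &
           plen P + d < 2^-1 * (plen P + l'))].

(* Here [smallest convex_set A] is the convex hull of A. *)
Definition displaceable_by_parallel_extended_probe_with_flag (R : realType)
    (D : seq (halfplane R)) (u : R * R) : Prop :=
  exists (P Q : probe_data R) (xf xf' : R * R) (lf : R),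
    let w := ivec R (pdir P) in
    [/\ [/\ is_probe D P, is_probe D Q, probe_set Q (pend P)
          & pairing (conormal (pfacet Q)) w = 0],
        [/\ probe_set Q xf, probe_set Q xf' & 0 <= lf],
        smallest (@convex_set R (R * R)%type)
          [set y | y \in [:: xf; xf'; xf + lf *: w; xf' + lf *: w]]
          `<=` polygon D,
        probe_interior P u /\
        facet_distance u (pfacet P) < 2^-1 * (plen P + lf)
      & exists2 d : R, affine_distance xf xf' d &
          facet_distance (pend P) (pfacet Q) < d].

Definition displaceable_by_probes_or_extended_probes (R : realType)
    (D : seq (halfplane R)) (u : R * R) : Prop :=
  [\/ displaceable_by_probe D u,
      displaceable_by_symmetric_extended_probe D u
    | displaceable_by_parallel_extended_probe_with_flag D u].

Definition ell1 (R : realType) (kappa1 : R) (x : R * R) : R := x.2 + kappa1.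

Definition ell2 (R : realType) (E1 : int) (kappa2 : R) (x : R * R) : R :=
  - x.1 + E1%:~R * x.2 + kappa2.

(* The half-planes x_1 >= 0, ell1 >= 0, ell2 >= 0 and
   - E2 x_1 + (E1 E2 - 1) x_2 >= 0. *)
Definition Delta_bar (R : realType) (E1 E2 : int) (kappa1 kappa2 : R) :
  seq (halfplane R) :=
  [:: ((1, 0), 0); ((0, 1), kappa1); ((-1, E1), kappa2);
      ((- E2, E1 * E2 - 1), 0)].

(* The four conormals are pairwise distinct and primitive, so the polygon has
   four edges exactly when each of its half-planes contributes one. *)
Definition has_four_edges (R : realType) (E1 E2 : int) (kappa1 kappa2 : R) :
  Prop :=
  forall F, F \in Delta_bar E1 E2 kappa1 kappa2 ->
    is_edge (Delta_bar E1 E2 kappa1 kappa2) F.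

Definition is_max (R : realType) (A : set R) (m : R) : Prop :=
  A m /\ ubound A m.

Definition exceptional_ray (R : realType) (E1 E2 : int) (kappa1 kappa2 : R) :
  set (R * R) :=
  [set x | ell1 kappa1 x = ell2 E1 kappa2 x /\
     exists2 m : R,
       is_max (ell1 kappa1 @`
         (polygon (Delta_bar E1 E2 kappa1 kappa2) `&`
          [set y | ell2 E1 kappa2 y = 0])) m &
       m <= ell1 kappa1 x].

(* Main.v *)
Require Import Defs.
From mathcomp Require Import all_boot all_order all_algebra.
From mathcomp Require Import all_classical all_reals all_analysis.
From mathcomp Require Import ring lra.
Import Order.TTheory GRing.Theory Num.Theory.
Import numFieldNormedType.Exports.
Local Open Scope classical_set_scope.
Local Open Scope ring_scope.

(** The two edges between the vertical axis and the sloping line through the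
    origin have conormals (0, 1) and (-1, E1), of determinant 1, so that
    p = ell1 and q = ell2 are integral affine coordinates.  In them, with
    a = E1, b = E2, c1 = kappa2 - a kappa1 and c2 = kappa1 - b kappa2, the
    polygon is
      p >= 0,   q >= 0,   q <= a p + c1,   p <= b q + c2,
    which is symmetric under (p, a, c1) <-> (q, b, c2).  Having four edges
    means that c1 and c2 are positive, and the exceptional ray is
    p = q >= c2, where (c2, 0) is the vertex on the edge q = 0 farthest from
    the corner p = q = 0.

    Since a, b >= 2, the diagonal direction (1, 1) increases every one of the
    four levels: it is interior to the recession cone.  Hence a probe Q in this
    direction can be prolonged for ever, and the polygon contains, far out
    along Q, parallelograms of any width and of any length in any given
    direction.  A probe P ending on Q and parallel to the facet of Q may then
    be completed by a flag of any length, and every point of the interior of P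
    is displaced ([flag_along_recession_ray]).  This disposes of all points off
    the diagonal: if p < q, take P going down from the edge q = a p + c1 and Q
    from a point of the edge p = 0 so close to the corner that P passes
    through (p, q) before it meets Q ([displaceable_above_diagonal]); if
    q < p, exchange the coordinates ([displaceable_below_diagonal]).

    For a point (p, p) with p < c2, the vertical line through it starts on the
    edge q = 0 and has length a p + c1 > 2 p, so that an ordinary probe
    suffices ([displaceable_on_diagonal]). *)

(** * Levels and probes in an arbitrary polygon *)

Lemma levelD (R : realType) (F : halfplane R) (x w : R * R) (t : R) :
  level F (x + t *: w) = level F x + t * pairing (conormal F) w.
Proof.
rewrite /level /pairing /= -[t *: w.1]/(t * w.1) -[t *: w.2]/(t * w.2).
by ring.
Qed.

Lemma level_continuous (R : realType) (F : halfplane R) :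
  continuous (level F : R * R -> R).
Proof.
move=> x; apply: cvgD; last exact: cvg_cst.
by apply: cvgD; apply: cvgM; [exact: cvg_cst|exact: cvg_fst|
  exact: cvg_cst|exact: cvg_snd].
Qed.

Lemma segment_sub_polygon (R : realType) (D : seq (halfplane R))
    (b w : R * R) (l : R) :
  polygon D b -> polygon D (b + l *: w) -> segment b w l `<=` polygon D.
Proof.
move=> Db De _ [t /andP[t0 tl] ->] F FD.
have := Db F FD; have := De F FD; rewrite !levelD.
move: (level F b) (pairing _ _) => p s; have [s0|s0] := leP 0 s; first by nra.
by have := ler_wnM2r (ltW s0) tl; lra.
Qed.

Lemma polygon_convex (R : realType) (D : seq (halfplane R)) :
  @convex_set R (R * R)%type (polygon D).
Proof.
move=> x y k; rewrite !inE => Dx Dy F FD.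
have k0 : 0 <= k%:num := ge0 k.
have k1 : k%:num <= 1 := le1 k.
have -> : level F (conv k x y : (R * R)%type) =
    k%:num * level F x + (1 - k%:num) * level F y.
  have conv1E : (conv k x y : R * R).1 = k%:num * x.1 + (1 - k%:num) * y.1.
    by [].
  have conv2E : (conv k x y : R * R).2 = k%:num * x.2 + (1 - k%:num) * y.2.
    by [].
  by rewrite /level /pairing conv1E conv2E; ring.
by rewrite addr_ge0// mulr_ge0 ?subr_ge0 ?Dx ?Dy.
Qed.

(** A point of the polygon on a single wall has a neighbourhood in which that
    wall is the only active constraint. *)
Lemma facet_interiorI (R : realType) (D : seq (halfplane R))
    (F : halfplane R) (x : R * R) :
  wall F x -> (forall G, G \in D -> G != F -> 0 < level G x) ->
  facet_interior D F x.
Proof.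
move=> Fx Dx; split=> //; rewrite near_withinE.
have : \forall y \near x, forall G, G \in D -> G != F -> 0 < level G y.
  elim: D Dx => [|G D IH] Dx; first by apply: filterE.
  have IHD : \forall y \near x, forall G, G \in D -> G != F -> 0 < level G y.
    by apply: IH => H HD; apply: Dx; rewrite inE HD orbT.
  have [->|GF] := eqVneq G F.
    apply: filterS IHD => y IHy H.
    by rewrite inE => /orP[/eqP ->|HD]; [rewrite eqxx|exact: IHy].
  have G0 : \forall y \near x, 0 < level G y.
    by apply: (cvgr_gt _ (level_continuous R G x)); apply: Dx;
      rewrite ?mem_head.
  apply: filterS2 G0 IHD => y Gy IHy H.
  by rewrite inE => /orP[/eqP ->|HD] //; exact: IHy.
apply: filterS => y Dy Fy; split=> // G GD.
by have [->|GF] := eqVneq G F; [rewrite Fy | exact/ltW/Dy].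
Qed.

(** If a level vanished at an interior point, moving slightly against its
    conormal would leave the polygon. *)
Lemma interior_level_gt0 (R : realType) (D : seq (halfplane R))
    (F : halfplane R) (x : R * R) :
  F \in D -> conormal F != (0, 0) -> interior (polygon D) x -> 0 < level F x.
Proof.
move=> FD F0 Dx.
pose w := ivec R (conormal F).
have w0 : 0 < pairing (conormal F) w.
  rewrite /w /pairing /ivec; case: (conormal F) F0 => m n /= mn0.
  rewrite -!expr2 lt_neqAle eq_sym paddr_eq0 ?sqr_ge0// addr_ge0 ?sqr_ge0//.
  by rewrite !sqrf_eq0 !intr_eq0 andbT.
have : x + t *: - w @[t --> (0 : R)] --> x.
  rewrite -[X in _ --> X]addr0 -[X in _ + X](scale0r (- w)).
  by apply: cvgD; [exact: cvg_cst|apply: cvgZr_tmp; exact: cvg_id].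
move=> /(_ _ Dx) /nbhs_ballP[e /= e0 he].
have /he /(_ F FD) : ball (0 : R) e (e / 2).
  by rewrite -ball_normE /= sub0r normrN ger0_norm; lra.
rewrite levelD.
have -> : pairing (conormal F) (- w) = - pairing (conormal F) w.
  by rewrite /pairing /=; ring.
by nra.
Qed.

Lemma is_probeI (R : realType) (D : seq (halfplane R)) (F : halfplane R)
    (b : R * R) (v : int * int) (l : R) :
  F \in D -> wall F b -> (forall G, G \in D -> G != F -> 0 < level G b) ->
  primitive v -> pairing (conormal F) (ivec R v) = 1 -> 0 < l ->
  polygon D (b + l *: ivec R v) -> is_probe D (ProbeData F b v l).
Proof.
move=> FD Fb Db pv Fv l0 De; split=> //; first exact: facet_interiorI.
apply: segment_sub_polygon => // G GD.
by have [->|GF] := eqVneq G F; [rewrite Fb | exact/ltW/Db].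
Qed.

(** Each level grows linearly along w, and there are finitely many of them. *)
Lemma recession_eventually (R : realType) (D : seq (halfplane R))
    (x w : R * R) :
  (forall G, G \in D -> 0 < pairing (conormal G) w) ->
  exists T, forall t, T <= t -> polygon D (x + t *: w).
Proof.
elim: D => [|G D IH] Dw; first by exists 0 => t _ F; rewrite in_nil.
have [F FD|T hT] := IH; first by apply: Dw; rewrite inE FD orbT.
have Gw : 0 < pairing (conormal G) w by apply: Dw; rewrite mem_head.
exists (Num.max T (- level G x / pairing (conormal G) w)) => t.
rewrite ge_max => /andP[Tt xt] F; rewrite inE => /orP[/eqP ->|]; last exact: hT.
by rewrite levelD; move: xt; rewrite ler_pdivrMr//; lra.
Qed.

(** When v is interior to the recession cone, the probe leaving G at b in the
    direction v may be prolonged indefinitely, and far out along it the polygon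
    contains flags of any prescribed length and width.  So a probe P ending on
    it displaces its whole interior, provided only that P is parallel to G. *)
Lemma flag_along_recession_ray (R : realType) (D : seq (halfplane R))
    (P : probe_data R) (G : halfplane R) (b : R * R) (v : int * int) (s : R)
    (u : R * R) :
  is_probe D P -> probe_interior P u ->
  G \in D -> wall G b -> (forall H, H \in D -> H != G -> 0 < level H b) ->
  primitive v -> pairing (conormal G) (ivec R v) = 1 ->
  (forall H, H \in D -> 0 < pairing (conormal H) (ivec R v)) ->
  0 <= s -> pend P = b + s *: ivec R v ->
  pairing (conormal G) (ivec R (pdir P)) = 0 ->
  displaceable_by_parallel_extended_probe_with_flag D u.
Proof.
move=> hP uP GD Gb Db pv Gv Dv s0 Pe GP.
(* Any flag at least this long satisfies the length inequality at u. *)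
pose w := ivec R (pdir P); pose lf := 2 * facet_distance u (pfacet P).
have lf0 : 0 <= lf by rewrite mulr_ge0 ?normr_ge0.
have bD : polygon D b.
  by move=> H HD; have [->|/(Db _ HD)/ltW//] := eqVneq H G; rewrite Gb.
have rayD t : 0 <= t -> polygon D (b + t *: ivec R v).
  by move=> t0 H HD; rewrite levelD addr_ge0 ?bD// mulr_ge0// ltW// Dv.
have [T hT] := @recession_eventually R D (b + lf *: w) (ivec R v) Dv.
(* The flag stands on the part of the ray between t1 and t2; its width s + 1
   exceeds the distance s from the end of P to G. *)
pose t1 := Num.max T 0; pose t2 := t1 + s + 1.
have t10 : 0 <= t1 by rewrite le_max lexx orbT.
have Tt1 : T <= t1 by rewrite le_max lexx.
have t12 : t1 <= t2 by rewrite /t2; lra.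
have st2 : s <= t2 by rewrite /t2; lra.
have t20 : 0 < t2 by rewrite /t2; lra.
have l0 : 0 < plen P by case: hP.
exists P, (ProbeData G b v t2), (b + t1 *: ivec R v), (b + t2 *: ivec R v), lf.
split=> /=.
- split=> //; first by apply: is_probeI => //; exact/rayD/ltW.
  by exists s => //; rewrite s0.
- by split=> //; [exists t1|exists t2] => //; rewrite ?t10 ?lexx ?(ltW t20).
- apply: smallest_sub; first exact: polygon_convex.
  move=> y /=; rewrite !inE => /or4P[] /eqP ->.
  + exact: rayD.
  + exact/rayD/ltW.
  + by rewrite addrAC; apply: hT.
  + by rewrite addrAC; apply: hT; exact: le_trans t12.
- by split=> //; rewrite /lf; lra.
exists (s + 1); last first.
  by rewrite Pe /facet_distance levelD Gb Gv add0r mulr1 ger0_norm//; lra.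
exists v, (t1 - t2); split=> //.
  by rewrite opprD addrACA subrr add0r -scalerBl.
by rewrite /t2 ler0_norm; lra.
Qed.

(** * Coordinates at the corner of the two middle edges *)

(** The inverse of x |-> (ell1 x, ell2 x). *)
Definition corner_chart (R : realType) (E1 : int) (kappa1 kappa2 p q : R) :
  R * R := (E1%:~R * (p - kappa1) - q + kappa2, p - kappa1).

Lemma corner_chartK (R : realType) (E1 : int) (kappa1 kappa2 : R) (x : R * R) :
  corner_chart R E1 kappa1 kappa2 (ell1 kappa1 x) (ell2 E1 kappa2 x) = x.
Proof.
by case: x => x y; rewrite /corner_chart /ell1 /ell2 /=; congr pair; ring.
Qed.

(** The integral vector v has components v.2 and E1 * v.2 - v.1 in the chart. *)
Lemma corner_chart_translate (R : realType) (E1 : int)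
    (kappa1 kappa2 p q t : R) (v : int * int) :
  corner_chart R E1 kappa1 kappa2 p q + t *: ivec R v =
  corner_chart R E1 kappa1 kappa2
    (p + t * v.2%:~R) (q + t * (E1 * v.2 - v.1)%:~R).
Proof.
rewrite /corner_chart /ivec rmorphB rmorphM.
congr pair => /=; rewrite -?[t *: v.1%:~R]/(t * v.1%:~R)
  -?[t *: v.2%:~R]/(t * v.2%:~R); ring.
Qed.

Lemma level_corner_chart (R : realType) (E1 E2 : int)
    (kappa1 kappa2 p q : R) :
  let x := corner_chart R E1 kappa1 kappa2 p q in
  [/\ level ((1, 0), 0) x = E1%:~R * p - q + (kappa2 - E1%:~R * kappa1),
      level ((0, 1), kappa1) x = p,
      level ((-1, E1), kappa2) x = q
    & level ((- E2, E1 * E2 - 1), 0) x =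
        E2%:~R * q - p + (kappa1 - E2%:~R * kappa2)].
Proof.
by split; rewrite /level /pairing /= ?rmorphB ?rmorphN ?rmorphM /=; ring.
Qed.

Lemma forall_Delta_bar (R : realType) (E1 E2 : int) (kappa1 kappa2 : R)
    (Pr : halfplane R -> Prop) :
  Pr ((1, 0), 0) -> Pr ((0, 1), kappa1) -> Pr ((-1, E1), kappa2) ->
  Pr ((- E2, E1 * E2 - 1), 0) ->
  forall F, F \in Delta_bar E1 E2 kappa1 kappa2 -> Pr F.
Proof. by move=> ? ? ? ? F; rewrite !inE => /or4P[] /eqP ->. Qed.

Lemma polygon_corner_chart (R : realType) (E1 E2 : int)
    (kappa1 kappa2 p q : R) :
  polygon (Delta_bar E1 E2 kappa1 kappa2)
    (corner_chart R E1 kappa1 kappa2 p q) <->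
  [/\ 0 <= p, 0 <= q, q <= E1%:~R * p + (kappa2 - E1%:~R * kappa1)
    & p <= E2%:~R * q + (kappa1 - E2%:~R * kappa2)].
Proof.
have [LA L1 L2 LB] := level_corner_chart R E1 E2 kappa1 kappa2 p q.
split=> [Dx|[p0 q0 qA pB]].
  move: (Dx ((1, 0), 0)) (Dx ((0, 1), kappa1)) (Dx ((-1, E1), kappa2))
    (Dx ((- E2, E1 * E2 - 1), 0)).
  rewrite LA L1 L2 LB !inE !eqxx !orbT.
  by move=> /(_ isT) ? /(_ isT) ? /(_ isT) ? /(_ isT) ?; split=> //; lra.
by apply: forall_Delta_bar; rewrite ?LA ?L1 ?L2 ?LB //; lra.
Qed.

(** In the chart the edge p = 0 is given by 0 <= q <= c1 and the edge q = 0 by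
    0 <= p <= c2; neither has two points unless c1 and c2 are positive. *)
Lemma Delta_bar_edges (R : realType) (E1 E2 : int) (kappa1 kappa2 : R) :
  has_four_edges E1 E2 kappa1 kappa2 ->
  0 < kappa2 - E1%:~R * kappa1 /\ 0 < kappa1 - E2%:~R * kappa2.
Proof.
move=> four.
have facetP F x : facet (Delta_bar E1 E2 kappa1 kappa2) F x ->
    exists p q, [/\ x = corner_chart R E1 kappa1 kappa2 p q,
      level F (corner_chart R E1 kappa1 kappa2 p q) = 0, 0 <= p, 0 <= q
    & q <= E1%:~R * p + (kappa2 - E1%:~R * kappa1) /\
      p <= E2%:~R * q + (kappa1 - E2%:~R * kappa2)].
  rewrite -(corner_chartK R E1 kappa1 kappa2 x) => -[/polygon_corner_chart[]].
  by move=> *; exists (ell1 kappa1 x), (ell2 E1 kappa2 x).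
split; rewrite ltNge; apply/negP => c0.
- have [|x [y [/facetP[p [q [xE]]]]]] := four ((0, 1), kappa1).
    by rewrite !inE eqxx orbT.
  have [_ -> _ _] := level_corner_chart R E1 E2 kappa1 kappa2 p q.
  move=> p0 _ q0 [qA _] /facetP[p' [q' [yE]]].
  have [_ -> _ _] := level_corner_chart R E1 E2 kappa1 kappa2 p' q'.
  move=> p'0 _ q'0 [q'A _]; apply; rewrite xE yE p0 p'0.
  by congr corner_chart; rewrite p0 in qA; rewrite p'0 in q'A; lra.
- have [|x [y [/facetP[p [q [xE]]]]]] := four ((-1, E1), kappa2).
    by rewrite !inE eqxx !orbT.
  have [_ _ -> _] := level_corner_chart R E1 E2 kappa1 kappa2 p q.
  move=> q0 p0 _ [_ pB] /facetP[p' [q' [yE]]].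
  have [_ _ -> _] := level_corner_chart R E1 E2 kappa1 kappa2 p' q'.
  move=> q'0 p'0 _ [_ p'B]; apply; rewrite xE yE q0 q'0.
  by congr corner_chart; rewrite q0 in pB; rewrite q'0 in p'B; lra.
Qed.

(** * Displacing the fibers *)

(** In the chart the direction is (1, 1), on which the conormals take the values
    E1 - 1, 1, 1 and E2 - 1. *)
Lemma diagonal_recession (R : realType) (E1 E2 : int) (kappa1 kappa2 : R) :
  2 <= E1 -> 2 <= E2 -> forall H, H \in Delta_bar E1 E2 kappa1 kappa2 ->
  0 < pairing (conormal H) (ivec R (E1 - 1, 1)).
Proof.
move=> E1ge E2ge.
have a2 : 2 <= E1%:~R :> R by rewrite (ler_int R 2).
have b2 : 2 <= E2%:~R :> R by rewrite (ler_int R 2).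
apply: forall_Delta_bar; rewrite /pairing /= ?rmorphB ?rmorphN ?rmorphM /=; lra.
Qed.

(** The ray Q leaves the edge p = 0 in the diagonal direction, close enough to
    the corner to pass below (p, q), and P comes down from the edge
    q = E1 p + c1 through (p, q) until it meets Q. *)
Lemma displaceable_above_diagonal (R : realType) (E1 E2 : int)
    (kappa1 kappa2 p q : R) :
  2 <= E1 -> 2 <= E2 ->
  0 < kappa2 - E1%:~R * kappa1 -> 0 < kappa1 - E2%:~R * kappa2 ->
  0 < p -> p < q -> q < E1%:~R * p + (kappa2 - E1%:~R * kappa1) ->
  displaceable_by_parallel_extended_probe_with_flag
    (Delta_bar E1 E2 kappa1 kappa2) (corner_chart R E1 kappa1 kappa2 p q).
Proof.
move=> E1ge E2ge c10 c20 p0 pq qA.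
have a2 : 2 <= E1%:~R :> R by rewrite (ler_int R 2).
have b2 : 2 <= E2%:~R :> R by rewrite (ler_int R 2).
pose c1 := kappa2 - E1%:~R * kappa1; pose c2 := kappa1 - E2%:~R * kappa2.
rewrite -/c1 in c10 qA; rewrite -/c2 in c20.
(* Q starts at (0, e): on the edge p = 0, and meeting the vertical line through
   (p, q) at height p + e < q. *)
pose e := Num.min c1 (q - p) / 2.
have e0 : 0 < e by rewrite divr_gt0// lt_min; apply/andP; split; lra.
have [ec1 epq] : e < c1 /\ p + e < q.
  have m1 : Num.min c1 (q - p) <= c1 by rewrite ge_min lexx.
  have m2 : Num.min c1 (q - p) <= q - p by rewrite ge_min lexx orbT.
  by move: e0; rewrite /e; split; lra.
have pY : 2 * p < E1%:~R * p + c1 by nra.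
have Yb : 2 * (E1%:~R * p + c1) <= E2%:~R * (E1%:~R * p + c1).
  by rewrite ler_wpM2r//; lra.
have peb : 2 * (p + e) <= E2%:~R * (p + e) by rewrite ler_wpM2r//; lra.
have eb : 0 < E2%:~R * e by rewrite mulr_gt0//; lra.
pose chart := corner_chart R E1 kappa1 kappa2.
have lv x y := level_corner_chart R E1 E2 kappa1 kappa2 x y.
pose P := ProbeData ((1, 0), 0) (chart p (E1%:~R * p + c1)) (1, 0)
  (E1%:~R * p + c1 - (p + e)).
have PE t : pbase P + t *: ivec R (pdir P) =
    chart p (E1%:~R * p + c1 - t).
  rewrite /= corner_chart_translate /=; congr corner_chart.
    by rewrite mulr0 addr0.
  by rewrite mulr0 sub0r rmorphN1 mulrN1.
apply: (@flag_along_recession_ray _ _ P ((0, 1), kappa1) (chart 0 e)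
  (E1 - 1, 1) p).
- apply: is_probeI => //.
  + by rewrite !inE eqxx.
  + have [LA _ _ _] := lv p (E1%:~R * p + c1).
    by apply: (etrans LA); rewrite -/c1; ring.
  + have [_ L1 L2 LB] := lv p (E1%:~R * p + c1).
    by apply: forall_Delta_bar; rewrite ?eqxx // => _;
      rewrite ?L1 ?L2 ?LB -/c1 -/c2//; lra.
  + by rewrite /pairing /=; ring.
  + by move=> /=; nra.
  + by rewrite PE; apply/polygon_corner_chart; rewrite -/c1 -/c2; split; lra.
- exists (E1%:~R * p + c1 - q); first by rewrite /P /=; apply/andP; split; lra.
  by rewrite PE; congr corner_chart; ring.
- by rewrite !inE eqxx orbT.
- by rewrite /wall /=; have [_ -> _ _] := lv 0 e.
- have [LA _ L2 LB] := lv 0 e.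
  by apply: forall_Delta_bar; rewrite ?eqxx // => _;
      rewrite ?LA ?L2 ?LB -/c1 -/c2//; lra.
- by rewrite /primitive coprimezE coprimen1.
- by rewrite /pairing /=; ring.
- exact: diagonal_recession.
- exact: ltW.
- rewrite /pend PE corner_chart_translate; congr corner_chart => /=.
  + by rewrite add0r mulr1.
  + by rewrite mulr1 opprB addrCA subrr; ring.
- by rewrite /pairing /=; ring.
Qed.

(** The mirror image of [displaceable_above_diagonal]: Q starts on the edge
    q = 0 and P runs horizontally from the edge p = E2 q + c2. *)
Lemma displaceable_below_diagonal (R : realType) (E1 E2 : int)
    (kappa1 kappa2 p q : R) :
  2 <= E1 -> 2 <= E2 ->
  0 < kappa2 - E1%:~R * kappa1 -> 0 < kappa1 - E2%:~R * kappa2 ->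
  0 < q -> q < p -> p < E2%:~R * q + (kappa1 - E2%:~R * kappa2) ->
  displaceable_by_parallel_extended_probe_with_flag
    (Delta_bar E1 E2 kappa1 kappa2) (corner_chart R E1 kappa1 kappa2 p q).
Proof.
move=> E1ge E2ge c10 c20 q0 qp pB.
have a2 : 2 <= E1%:~R :> R by rewrite (ler_int R 2).
have b2 : 2 <= E2%:~R :> R by rewrite (ler_int R 2).
pose c1 := kappa2 - E1%:~R * kappa1; pose c2 := kappa1 - E2%:~R * kappa2.
rewrite -/c2 in c20 pB; rewrite -/c1 in c10.
pose e := Num.min c2 (p - q) / 2.
have e0 : 0 < e by rewrite divr_gt0// lt_min; apply/andP; split; lra.
have [ec2 eqp] : e < c2 /\ q + e < p.
  have m1 : Num.min c2 (p - q) <= c2 by rewrite ge_min lexx.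
  have m2 : Num.min c2 (p - q) <= p - q by rewrite ge_min lexx orbT.
  by move: e0; rewrite /e; split; lra.
have qX : 2 * q < E2%:~R * q + c2 by nra.
have Xa : 2 * (E2%:~R * q + c2) <= E1%:~R * (E2%:~R * q + c2).
  by rewrite ler_wpM2r//; lra.
have qea : 2 * (q + e) <= E1%:~R * (q + e) by rewrite ler_wpM2r//; lra.
have ea : 0 < E1%:~R * e by rewrite mulr_gt0//; lra.
pose chart := corner_chart R E1 kappa1 kappa2.
have lv x y := level_corner_chart R E1 E2 kappa1 kappa2 x y.
pose P := ProbeData ((- E2, E1 * E2 - 1), 0) (chart (E2%:~R * q + c2) q)
  (- E1, -1) (E2%:~R * q + c2 - (q + e)).
have PE t : pbase P + t *: ivec R (pdir P) =
    chart (E2%:~R * q + c2 - t) q.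
  rewrite /= corner_chart_translate /=; congr corner_chart.
    by rewrite rmorphN1 mulrN1.
  by rewrite mulrN1 subrr mulr0 addr0.
apply: (@flag_along_recession_ray _ _ P ((-1, E1), kappa2) (chart e 0)
  (E1 - 1, 1) q).
- apply: is_probeI => //.
  + by rewrite !inE eqxx !orbT.
  + have [_ _ _ LB] := lv (E2%:~R * q + c2) q.
    by apply: (etrans LB); rewrite -/c2; ring.
  + have [LA L1 L2 _] := lv (E2%:~R * q + c2) q.
    apply: forall_Delta_bar; rewrite ?eqxx // => _;
      rewrite ?LA ?L1 ?L2 -/c1 -/c2//; lra.
  + by rewrite /primitive coprimezE abszN coprimen1.
  + by rewrite /pairing /= !rmorphN rmorphB rmorphM /=; ring.
  + by move=> /=; lra.
  + by rewrite PE; apply/polygon_corner_chart; rewrite -/c1 -/c2; split; lra.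
- exists (E2%:~R * q + c2 - p); first by rewrite /P /=; apply/andP; split; lra.
  by rewrite PE; congr corner_chart; ring.
- by rewrite !inE eqxx !orbT.
- by have [_ _ L2 _] := lv e 0.
- have [LA L1 _ LB] := lv e 0.
  apply: forall_Delta_bar; rewrite ?eqxx // => _;
    rewrite ?LA ?L1 ?LB -/c1 -/c2//; lra.
- by rewrite /primitive coprimezE coprimen1.
- by rewrite /pairing /= rmorphB /=; ring.
- exact: diagonal_recession.
- exact: ltW.
- rewrite /pend PE corner_chart_translate; congr corner_chart => /=.
  + by rewrite mulr1; ring.
  + by rewrite add0r mulr1 opprB addrCA subrr addr0 mulr1.
- by rewrite /pairing /= !rmorphN /=; ring.
Qed.

(** The probe runs vertically in the chart from (p, 0) to the edge
    q = E1 p + c1; the bound p < c2 puts its base inside the edge q = 0, and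
    E1 >= 2 puts (p, p) below its midpoint. *)
Lemma displaceable_on_diagonal (R : realType) (E1 E2 : int)
    (kappa1 kappa2 p : R) :
  2 <= E1 -> 2 <= E2 -> 0 < kappa2 - E1%:~R * kappa1 ->
  0 < p -> p < kappa1 - E2%:~R * kappa2 ->
  displaceable_by_probe
    (Delta_bar E1 E2 kappa1 kappa2) (corner_chart R E1 kappa1 kappa2 p p).
Proof.
move=> E1ge E2ge c10 p0 pc2.
have a2 : 2 <= E1%:~R :> R by rewrite (ler_int R 2).
have b2 : 2 <= E2%:~R :> R by rewrite (ler_int R 2).
pose c1 := kappa2 - E1%:~R * kappa1; pose c2 := kappa1 - E2%:~R * kappa2.
rewrite -/c2 in pc2; rewrite -/c1 in c10.
have pY : 2 * p < E1%:~R * p + c1 by nra.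
have Yb : 0 < E2%:~R * (E1%:~R * p + c1) by rewrite mulr_gt0//; lra.
pose chart := corner_chart R E1 kappa1 kappa2.
have E t : chart p 0 + t *: ivec R (-1, 0) = chart p t.
  by rewrite corner_chart_translate; congr corner_chart => /=; ring.
have [_ _ L2pp _] := level_corner_chart R E1 E2 kappa1 kappa2 p p.
have [LA L1 L2 LB] := level_corner_chart R E1 E2 kappa1 kappa2 p 0.
exists (ProbeData ((-1, E1), kappa2) (chart p 0) (-1, 0) (E1%:~R * p + c1)).
split.
- apply: is_probeI => //.
  + by rewrite !inE eqxx !orbT.
  + apply: forall_Delta_bar; rewrite ?eqxx // => _;
      rewrite ?LA ?L1 ?LB -/c1 -/c2//; lra.
  + by rewrite /pairing /=; ring.
  + lra.
  + rewrite E; apply/polygon_corner_chart; rewrite -/c1 -/c2; split; lra.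
- by exists p; [apply/andP; split=> /=; lra | rewrite E].
- by rewrite /facet_distance L2pp ger0_norm; [move=> /=; lra | exact: ltW].
Qed.

(** On the edge q = 0 the coordinate p is largest at the vertex (c2, 0). *)
Lemma exceptional_rayE (R : realType) (E1 E2 : int) (kappa1 kappa2 : R)
    (x : R * R) :
  2 <= E1 ->
  0 < kappa2 - E1%:~R * kappa1 -> 0 < kappa1 - E2%:~R * kappa2 ->
  exceptional_ray E1 E2 kappa1 kappa2 x <->
  ell1 kappa1 x = ell2 E1 kappa2 x /\
  kappa1 - E2%:~R * kappa2 <= ell1 kappa1 x.
Proof.
move=> E1ge c10 c20; pose c2 := kappa1 - E2%:~R * kappa2; rewrite -/c2 in c20 *.
have a2 : 2 <= E1%:~R :> R by rewrite (ler_int R 2).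
have max_c2 : is_max (ell1 kappa1 @`
    (polygon (Delta_bar E1 E2 kappa1 kappa2) `&`
     [set y | ell2 E1 kappa2 y = 0])) c2.
  split.
    exists (corner_chart R E1 kappa1 kappa2 c2 0).
      split; last by rewrite /ell2 /=; ring.
      by apply/polygon_corner_chart; rewrite -/c2; split; nra.
    by rewrite /ell1 /=; ring.
  move=> _ [y [+ y0] <-]; rewrite -{1}(corner_chartK R E1 kappa1 kappa2 y).
  move=> /polygon_corner_chart[_ _ _]; rewrite y0 -/c2.
  by rewrite mulr0 add0r.
split=> [[xe [m [_ m_ub] mx]]|[xe c2x]]; split=> //; last by exists c2.
exact: le_trans (m_ub _ max_c2.1) mx.
Qed.

Theorem corollary4p5p1 (R : realType) (E1 E2 : int) (kappa1 kappa2 : R)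
    (hE1 : 2 <= E1) (hE2 : 2 <= E2)
    (hkappa1 : kappa1 < 0) (hkappa2 : kappa2 < 0)
    (hfour : has_four_edges E1 E2 kappa1 kappa2) :
  (forall x : R * R,
     exceptional_ray E1 E2 kappa1 kappa2 x <->
     (x.1 = (E1 - 1)%:~R * x.2 + kappa2 - kappa1 /\
      - E2%:~R * kappa2 <= x.2)) /\
  (forall x : R * R,
     interior (polygon (Delta_bar E1 E2 kappa1 kappa2)) x ->
     ~ exceptional_ray E1 E2 kappa1 kappa2 x ->
     displaceable_by_probes_or_extended_probes
       (Delta_bar E1 E2 kappa1 kappa2) x).
Proof.
have [c10 c20] := Delta_bar_edges R E1 E2 kappa1 kappa2 hfour.
split=> x.
  apply: (iff_trans (exceptional_rayE R E1 E2 kappa1 kappa2 x hE1 c10 c20)).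
  rewrite /ell1 /ell2 rmorphB mulrBl mul1r mulNr.
  by split=> -[x1 x2]; split; lra.
move=> Dx not_ray.
have level_gt0 : forall F, F \in Delta_bar E1 E2 kappa1 kappa2 -> 0 < level F x.
  move=> F FD; apply: interior_level_gt0 Dx => //; move: F FD.
  apply: forall_Delta_bar; rewrite /conormal//= xpair_eqE oppr_eq0.
  by rewrite gt_eqF// (lt_le_trans _ hE2).
have [p0 q0 qA pB] : [/\ 0 < ell1 kappa1 x, 0 < ell2 E1 kappa2 x,
    ell2 E1 kappa2 x < E1%:~R * ell1 kappa1 x + (kappa2 - E1%:~R * kappa1)
  & ell1 kappa1 x < E2%:~R * ell2 E1 kappa2 x + (kappa1 - E2%:~R * kappa2)].
  move: (level_gt0 ((1, 0), 0)) (level_gt0 ((0, 1), kappa1))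
    (level_gt0 ((-1, E1), kappa2)) (level_gt0 ((- E2, E1 * E2 - 1), 0)).
  rewrite -{1 2 3 4}(corner_chartK R E1 kappa1 kappa2 x).
  have [-> -> -> ->] := level_corner_chart R E1 E2 kappa1 kappa2
    (ell1 kappa1 x) (ell2 E1 kappa2 x).
  rewrite !inE !eqxx !orbT => /(_ isT) ? /(_ isT) ? /(_ isT) ? /(_ isT) ?.
  by split=> //; lra.
rewrite -(corner_chartK R E1 kappa1 kappa2 x).
have [pq|qp|pq] := ltgtP (ell1 kappa1 x) (ell2 E1 kappa2 x).
- by apply: Or33; exact: displaceable_above_diagonal.
- by apply: Or33; exact: displaceable_below_diagonal.
apply: Or31; rewrite -pq; apply: displaceable_on_diagonal => //.
rewrite ltNge; apply/negP => c2p; apply: not_ray.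
by apply/exceptional_rayE.
Qed.
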